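(* If $\lambda$ is a complete partition, then $\lambda\in \Gamma$, where $\Gamma=\Gamma_1\cup\Gamma_2\cup\Gamma_3$ and $$\Gamma_1 = \{ \{a\}, \{1^a\}, \{2^a\}: a\geq 1 \},$$ $$\Gamma_2 = \{ \{a,b\}: a,b\geq 1,\ \gcd(a,b)\leq 2\} \cup \{ \{1^a,2^b\}: a\geq 1,\ b\geq 1\} \cup \{ \{1^a,b\}: a\geq 2,\ 3\leq b\leq 5\} \cup \{ \{1^2,b\}: b\geq 3\} \cup \{ \{2^a,b\}: a\geq 2,\ b\in\{3,4\}\} \cup \{ \{2^2,b\}: b\geq 5\text{ and odd}\} \cup \{ \{2^3,5\}\},$$ $$\Gamma_3 = \{ \{1^a,2^b,3\}: a\geq 1,\ b\geq 1\}.$$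
   Context: $Z_n=\{0,1,\dots,n-1\}$, and $S_n$ is the set of permutations of $Z_n$. A $2$-tournament on $Z_n$ assigns to each ordered pair of distinct vertices $(x,y)$ of $Z_n$ a nonnegative integer weight $\omega(x,y)$ with $\omega(x,y)+\omega(y,x)=2$; its score sequence is the nondecreasing sequence formed from the multiset of scores $\sum_{j\ne i}\omega(i,j)$, $i\in Z_n$. $\mathfrak{S}_n^2$ is the set of score sequences of $2$-tournaments on $Z_n$. For $\phi\in S_n$, the characteristic sequence $c(\phi)$ is the nondecreasing sequence formed from the multiset $\{i+\phi(i):i\in Z_n\}$, and $\mathfrak{C}_n=\{c(\phi):\phi\in S_n\}$. The shape of a finite sequence of length $n$ is the partition of $n$ (a multiset of positive integers with sum $n$) consisting of the multiplicities of the distinct values occurring in the sequence. Partitions are written as multisets, with $p^m$ denoting $m$ copies of the part $p$. For a partition $\lambda$ of a positive integer $n$, $\mathfrak{S}^2(\lambda)$ and $\mathfrak{C}(\lambda)$ are the sets of sequences in $\mathfrak{S}_n^2$ and in $\mathfrak{C}_n$, respectively, of shape $\lambda$. The partition $\lambda$ is complete if $\mathfrak{C}(\lambda)=\mathfrak{S}^2(\lambda)$, and incomplete otherwise. *)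

(* Defs.v *)
From mathcomp Require Import all_boot all_fingroup.

Set Implicit Arguments.
Unset Strict Implicit.
Unset Printing Implicit Defensive.

(* The values of [w] on the diagonal are unconstrained and are never used. *)
Definition two_tournament (n : nat) (w : 'I_n -> 'I_n -> nat) : Prop :=
  forall x y : 'I_n, x != y -> w x y + w y x = 2.

Definition score (n : nat) (w : 'I_n -> 'I_n -> nat) (i : 'I_n) : nat :=
  \sum_(j < n | j != i) w i j.

Definition score_sequence (n : nat) (w : 'I_n -> 'I_n -> nat) : seq nat :=
  sort leq [seq score w i | i <- enum 'I_n].

Definition is_score_sequence2 (n : nat) (s : seq nat) : Prop :=
  exists2 w : 'I_n -> 'I_n -> nat, two_tournament w & s = score_sequence w.

Definition char_sequence (n : nat) (phi : 'S_n) : seq nat :=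
  sort leq [seq (i + phi i)%N | i : 'I_n <- enum 'I_n].

Definition is_char_sequence (n : nat) (s : seq nat) : Prop :=
  exists phi : 'S_n, s = char_sequence phi.

(* Multisets of natural numbers, in particular partitions, are represented by
   lists; equality of multisets is [perm_eq]. *)
Definition is_partition (n : nat) (lambda : seq nat) : Prop :=
  all (fun p => 0 < p) lambda /\ sumn lambda = n.

Definition seq_shape (s : seq nat) : seq nat :=
  [seq count_mem x s | x <- undup s].

Definition in_S2 (n : nat) (lambda s : seq nat) : Prop :=
  is_score_sequence2 n s /\ perm_eq (seq_shape s) lambda.

Definition in_C (n : nat) (lambda s : seq nat) : Prop :=
  is_char_sequence n s /\ perm_eq (seq_shape s) lambda.

Definition complete (n : nat) (lambda : seq nat) : Prop :=
  forall s : seq nat, in_C n lambda s <-> in_S2 n lambda s.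

Definition Gamma1 (lambda : seq nat) : Prop :=
  exists2 a : nat, 1 <= a &
    [\/ perm_eq lambda [:: a],
        perm_eq lambda (nseq a 1) |
        perm_eq lambda (nseq a 2)].

Definition Gamma2 (lambda : seq nat) : Prop :=
     (exists a b : nat,
        [/\ 1 <= a, 1 <= b, gcdn a b <= 2 & perm_eq lambda [:: a; b]])
  \/ (exists a b : nat,
        [/\ 1 <= a, 1 <= b & perm_eq lambda (nseq a 1 ++ nseq b 2)])
  \/ (exists a b : nat,
        [/\ 2 <= a, 3 <= b <= 5 & perm_eq lambda (nseq a 1 ++ [:: b])])
  \/ (exists b : nat,
        3 <= b /\ perm_eq lambda (nseq 2 1 ++ [:: b]))
  \/ (exists a b : nat,
        [/\ 2 <= a, b = 3 \/ b = 4 & perm_eq lambda (nseq a 2 ++ [:: b])])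
  \/ (exists b : nat,
        [/\ 5 <= b, odd b & perm_eq lambda (nseq 2 2 ++ [:: b])])
  \/ perm_eq lambda (nseq 3 2 ++ [:: 5]).

Definition Gamma3 (lambda : seq nat) : Prop :=
  exists a b : nat,
    [/\ 1 <= a, 1 <= b & perm_eq lambda (nseq a 1 ++ nseq b 2 ++ [:: 3])].

Definition Gamma (lambda : seq nat) : Prop :=
  [\/ Gamma1 lambda, Gamma2 lambda | Gamma3 lambda].

(* Main.v *)
(* If all sums [i + phi i] are at most [M], the indices with [i > L] and those
   with [phi i > maxn L (M - L - 1)] form disjoint sets, all of whose sums exceed
   [L]; this bounds from below the number of large entries of a characteristic
   sequence.  Tournaments with two blocks, in which the vertices of the second
   block beat cyclically consecutive runs of the first block and all other games
   are drawn, violate this bound for a minimal list of shapes: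
     {a,b} with gcd(a,b) > 2,  {a,b,c} with 0 < a < b < c and c > 3,
     {1,1,1,b} and {2,2,2,b} with b > 5,  {2,2,b} with b > 5 even,
     {2,2,2,2,5}.
   Placing a block of [p] vertices with equal scores [p.-1] below a tournament
   adds a part [p] to its shape and preserves non-realizability, so a partition
   is incomplete as soon as it contains such a shape; the others are in Gamma. *)

Require Import Defs.
From mathcomp Require Import all_boot all_fingroup.
From mathcomp Require Import zify.

Set Implicit Arguments.
Unset Strict Implicit.
Unset Printing Implicit Defensive.

(** * Shapes of sequences and auxiliary facts on lists *)

Lemma seq_shape_perm (s t : seq nat) :
  perm_eq s t -> perm_eq (seq_shape s) (seq_shape t).
Proof.
move=> st; have /seq.permP cst := st.
rewrite /seq_shape (eq_map (fun x => cst (pred1 x))).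
by apply/perm_map/perm_undup/perm_mem.
Qed.

Lemma seq_shape_nseq_cat (k x : nat) (t : seq nat) :
  0 < k -> x \notin t -> seq_shape (nseq k x ++ t) = k :: seq_shape t.
Proof.
move=> k_gt0 xt; rewrite /seq_shape.
have -> : undup (nseq k x ++ t) = x :: undup t.
  case: k k_gt0 => // k _; elim: k => [|k IHk] /=; first by rewrite (negPf xt).
  by move: IHk => /= ->; rewrite inE eqxx.
rewrite /= count_cat count_nseq /= eqxx mul1n (count_memPn xt) addn0.
congr cons; apply/eq_in_map => y; rewrite mem_undup => yt.
rewrite count_cat count_nseq /=.
by case: eqP xt => [->|]; rewrite ?yt.
Qed.

Lemma seq_shape_nseq (k x : nat) : 0 < k -> seq_shape (nseq k x) = [:: k].
Proof. by move=> k_gt0; rewrite -[nseq k x]cats0 seq_shape_nseq_cat. Qed.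

Lemma seq_shape_map (f : nat -> nat) (s : seq nat) :
  injective f -> seq_shape (map f s) = seq_shape s.
Proof.
move=> f_inj; rewrite /seq_shape undup_map_inj // -map_comp.
apply: eq_map => x /=; rewrite count_map.
by apply: eq_count => y /=; rewrite (inj_eq f_inj).
Qed.

Lemma sumn_seq_shape (s : seq nat) : sumn (seq_shape s) = size s.
Proof.
rewrite sumnE /seq_shape big_map; under eq_bigr do rewrite -sum1_count.
rewrite (exchange_big_dep xpredT) //= -sum1_size !big_seq.
apply: eq_bigr => y ys; rewrite sum1_count.
rewrite (eq_count (a2 := pred1 y)) => [|x]; last by rewrite /= eq_sym.
by rewrite count_uniq_mem ?undup_uniq // mem_undup ys.
Qed.

Lemma sumn_leq (k : nat) (s : seq nat) : all (geq k) s -> sumn s <= size s * k.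
Proof. by elim: s => //= x s IHs /andP[xk /IHs]; apply: leq_add. Qed.

Lemma map_eq_nseq (S T : eqType) (f : S -> T) (y : T) (s : seq S) :
  {in s, forall x, f x = y} -> map f s = nseq (size s) y.
Proof.
move=> fE; rewrite -(size_map f); apply/all_pred1P; rewrite all_map.
by apply/allP => x /fE /= ->.
Qed.

(** * Characteristic sequences and obstructions to them *)

(** Characteristic sequences up to order. Functions on [nat] replace permutations of ordinals, so
    that removing a block, which changes [n], needs no casts. *)
Definition char_multiset (n : nat) (s : seq nat) : Prop :=
  exists f : nat -> nat,
    [/\ forall i, i < n -> f i < n, {in gtn n &, injective f} &
        perm_eq [seq i + f i | i <- iota 0 n] s].

Lemma char_sequence_multiset (n : nat) (s : seq nat) :
  is_char_sequence n s -> char_multiset n s.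
Proof.
case=> phi ->.
pose f i := oapp (fun o : 'I_n => val (phi o)) i (insub i).
have fE (o : 'I_n) : f o = phi o by rewrite /f valK.
exists f; split.
- by move=> i lt_in; rewrite (fE (Ordinal lt_in)).
- move=> i j lt_in lt_jn; rewrite (fE (Ordinal lt_in)) (fE (Ordinal lt_jn)).
  by move=> /val_inj /perm_inj [].
rewrite /char_sequence perm_sym perm_sort -val_enum_ord -map_comp.
by rewrite (eq_map (g := fun i : 'I_n => i + phi i)) // => i /=; rewrite fE.
Qed.

(* At least [n - L.+1] indices satisfy [i > L], and
   [n - maxn L.+1 (M - L)] others have a large [f i]; the bound [M] on
   [i + f i] makes these two sets disjoint. *)
Lemma char_multiset_count (n L M : nat) (s : seq nat) :
  char_multiset n s -> all (leq^~ M) s ->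
  (n - L.+1) + (n - maxn L.+1 (M - L)) <= count (ltn L) s.
Proof.
case=> f [f_lt f_inj f_s]; rewrite -(perm_all _ f_s) => /allP le_M.
rewrite -(seq.permP f_s) count_map; set T := maxn _ _.
have f_perm : perm_eq (map f (iota 0 n)) (iota 0 n).
  have Uf : uniq (map f (iota 0 n)).
    rewrite map_inj_in_uniq ?iota_uniq // => i j.
    by rewrite !mem_iota; apply: f_inj.
  apply: uniq_perm; rewrite ?iota_uniq //.
  have [] := uniq_min_size Uf (s2 := iota 0 n); rewrite ?size_map //.
  by move=> _ /mapP[i + ->]; rewrite !mem_iota; apply: f_lt.
have count_geq k : count (leq k) (iota 0 n) = n - k.
  elim: n {f_lt f_inj f_s le_M f_perm} => [|n IHn]; first by rewrite sub0n.
  by rewrite -addn1 iotaD count_cat IHn /=; lia.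
have := count_predUI (ltn L) (preim f (leq T)) (iota 0 n).
rewrite (eq_in_count (a1 := predI _ _) (a2 := pred0)) ?count_pred0; last first.
  move=> i i_n /=; have /= := le_M _ (map_f (fun i => i + f i) i_n).
  by rewrite /T; lia.
rewrite addn0 -(count_map f) (seq.permP f_perm) !count_geq => <-.
by apply: sub_count => i /=; rewrite /T; lia.
Qed.

(* The [p] indices with [i + f i = p.-1] are all [< p], hence exactly
   [0, ..., p.-1], and [f] reverses them. *)
Lemma char_multiset_block (p n : nat) (s : seq nat) :
  0 < p -> char_multiset (p + n) (nseq p p.-1 ++ map (addn p.*2) s) ->
  char_multiset n s.
Proof.
move=> p_gt0 [f [f_lt f_inj f_s]].
have low i : i < p -> i + f i = p.-1.
  have := seq.permP f_s (pred1 p.-1).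
  rewrite count_cat count_nseq /= eqxx mul1n.
  rewrite (count_memPn (_ : p.-1 \notin map _ s)); last first.
    by apply/mapP=> -[x _]; lia.
  rewrite iotaD map_cat count_cat addn0 addnC (count_memPn (_ : _ \notin _)).
    move=> cp lt_ip; have : all (pred1 p.-1) [seq i + f i | i <- iota 0 p].
      by rewrite all_count add0n in cp *; rewrite cp size_map size_iota.
    by rewrite all_map => /allP/(_ i); rewrite mem_iota /= => /(_ lt_ip) /eqP.
  by apply/mapP=> -[x]; rewrite mem_iota; lia.
have high i : p <= i < p + n -> p <= f i.
  move=> i_n; rewrite leqNgt; apply/negP => fi_p.
  (* The index [p.-1 - f i] is below [p] and [f] takes the same value there as at [i], against
     injectivity. *)
  have := low (p.-1 - f i) ltac:(lia) => ej.
  have : i = p.-1 - f i by apply: f_inj; rewrite ?inE; lia.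
  by lia.
exists (fun i => f (p + i) - p); split.
- move=> i lt_in; have := f_lt (p + i); have := high (p + i); lia.
- move=> i j; rewrite !inE => lt_in lt_jn eq_f.
  have hi := high (p + i) ltac:(lia); have hj := high (p + j) ltac:(lia).
  have : p + i = p + j by apply: f_inj; rewrite ?inE; lia.
  by lia.
move: f_s; rewrite iotaD map_cat.
have -> : [seq i + f i | i <- iota 0 p] = nseq p p.-1.
  rewrite (map_eq_nseq (y := p.-1)) ?size_iota // => i.
  by rewrite mem_iota => /low ->.
rewrite perm_cat2l add0n -[p in iota p n]addn0 iotaDl -map_comp.
have <- : [seq p.*2 + (i + (f (p + i) - p)) | i <- iota 0 n] =
          [seq ((fun i => i + f i) \o addn p) i | i <- iota 0 n].
  apply/eq_in_map => i; rewrite mem_iota /= => lt_in.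
  by have := high (p + i) ltac:(lia); lia.
by rewrite (map_comp (addn p.*2)) => /(perm_map_inj (@addnI _)).
Qed.

(** * Score sequences and stacking of a block *)

(* The weights are completed by [w x x = 1], so that row sums exceed the scores
   by one. *)
Definition score_multiset (n : nat) (s : seq nat) : Prop :=
  exists2 w : nat -> nat -> nat,
    forall x y, x < n -> y < n -> w x y + w y x = 2 &
    perm_eq [seq \sum_(j < n) w i j | i <- iota 0 n] (map S s).

Lemma score_multiset_sequence (n : nat) (s : seq nat) :
  score_multiset n s -> is_score_sequence2 n (sort leq s).
Proof.
case=> w w2 w_s; exists (fun i j : 'I_n => w i j) => [x y _|]; first exact: w2.
apply/(perm_sortP leq_total leq_trans anti_leq).
apply: (perm_map_inj succn_inj); rewrite perm_sym -(permPr w_s) -map_comp.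
rewrite -val_enum_ord -map_comp.
suff /eq_map -> : S \o score (fun i j : 'I_n => w i j) =1
                  (fun i => \sum_(j < n) w i j) \o val by exact: perm_refl.
move=> i /=.
have wii : w i i = 1 by have := w2 i i (ltn_ord i) (ltn_ord i); lia.
by rewrite (bigD1 i) //= wii add1n.
Qed.

(** The [p] new vertices draw among themselves and lose both points to every old vertex, which
    raises each old score by [p.*2]. *)
Lemma score_multiset_block (p n : nat) (s : seq nat) :
  0 < p -> score_multiset n s ->
  score_multiset (p + n) (nseq p p.-1 ++ map (addn p.*2) s).
Proof.
move=> p_gt0 [w w2 w_s].
exists (fun x y => if x < p then if y < p then 1 else 0
                   else if y < p then 2 else w (x - p) (y - p)).
  move=> x y lt_x lt_y; case: ltnP => px; case: ltnP => py //.
  by apply: w2; lia.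
rewrite iotaD !map_cat map_nseq prednK //; apply: perm_cat.
  rewrite (map_eq_nseq (y := p)) ?size_iota // => i.
  rewrite mem_iota /= => ->; rewrite big_split_ord /=.
  under eq_bigr => j _ do rewrite ltn_ord.
  under [X in _ + X]eq_bigr => j _ do rewrite ltnNge leq_addr.
  by rewrite !sum_nat_const !card_ord; lia.
rewrite add0n -[p in iota p n]addn0 iotaDl -map_comp.
rewrite (eq_map (g := addn p.*2 \o fun i => \sum_(j < n) w i j)) => [|i /=].
  rewrite -!map_comp (eq_map (f := S \o _) (g := addn p.*2 \o S)) => [|i /=].
    by rewrite map_comp [X in perm_eq _ X]map_comp perm_map.
  by rewrite addnS.
rewrite ltnNge leq_addr /= big_split_ord /= addKn; congr (_ + _).
  under eq_bigr => j _ do rewrite ltn_ord.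
  by rewrite sum_nat_const card_ord; lia.
by apply: eq_bigr => j _; rewrite ltnNge leq_addr addKn.
Qed.

(** * Cyclic runs and two-block tournaments *)

(* [residue_count m u t] is the number of [k < t] with [k = u %[mod m]]. *)
Definition residue_count (m u t : nat) : nat := t %/ m + (u < t %% m).

(** As a single quotient, the count inherits monotonicity and its behaviour under [t + m] from
    division. *)
Lemma residue_countE (m u t : nat) :
  u < m -> residue_count m u t = (t + (m - u.+1)) %/ m.
Proof.
move=> lt_um; rewrite /residue_count {3}(divn_eq t m) -addnA divnMDl; last lia.
have := ltn_pmod t (ltac:(lia) : 0 < m); move: (t %% m) => e lt_em.
congr (_ + _); case: ltnP => ue /=; last by rewrite divn_small; lia.
rewrite (_ : e + _ = 1 * m + (e - u.+1)); last lia.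
by rewrite divnMDl ?divn_small; lia.
Qed.

Lemma leq_residue_count (m u t t' : nat) :
  u < m -> t <= t' -> residue_count m u t <= residue_count m u t'.
Proof.
by move=> lt_um le_tt'; rewrite !residue_countE // leq_div2r ?leq_add2r.
Qed.

Lemma residue_count_addm (m u t : nat) :
  u < m -> residue_count m u (t + m) = (residue_count m u t).+1.
Proof.
move=> lt_um; rewrite !residue_countE // addnAC divnDr // divnn.
by rewrite (leq_ltn_trans _ lt_um) ?addn1.
Qed.

Lemma sum_residue_count (m t : nat) :
  0 < m -> \sum_(u < m) residue_count m u t = t.
Proof.
move=> m_gt0; rewrite big_split /= sum_nat_const card_ord mulnC.
rewrite {3}(divn_eq t m); congr (_ + _).
have := ltn_pmod t m_gt0; move: (t %% m) => e lt_em {m_gt0}.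
suff -> : \sum_(u < m) (u < e) = minn e m by lia.
elim: m {lt_em} => [|m IHm]; first by rewrite big_ord0 minn0.
by rewrite big_ord_recr /= IHm; case: ltnP; lia.
Qed.

(* Split the vertices into blocks of sizes [m] and [size xs].  Vertex [v] of the
   second block beats [nth 0 xs v] vertices of the first one, namely the next
   ones in cyclic order after those beaten by [v.-1]; all other games are drawn.
   Hence each vertex of the first block loses [p] or [p.+1] games. *)
Lemma score_multiset_cyclic (m p e : nat) (xs : seq nat) :
  e < m -> all (geq m) xs -> sumn xs = p * m + e ->
  score_multiset (m + size xs)
    (nseq e (m + size xs - p.+2) ++ nseq (m - e) (m + size xs - p.+1) ++
     map (addn (m + size xs).-1) xs).
Proof.
move=> lt_em xs_m sum_xs; set r := size xs.
pose N v := sumn (take v xs).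
have N_step v : v < r -> N v.+1 = N v + nth 0 xs v.
  by move=> lt_vr; rewrite /N (take_nth 0) // sumn_rcons.
have xs_nth v : v < r -> nth 0 xs v <= m.
  by move=> lt_vr; apply: (allP xs_m); rewrite mem_nth.
(* The wins of [v] are the integers in [[N v, N v.+1)] read modulo [m]. As this run has length at
   most [m], [h u v] is 1 if [v] beats [u] and 0 otherwise; the row sums telescope. *)
pose h u v := residue_count m u (N v.+1) - residue_count m u (N v).
have h_le1 u v : u < m -> v < r -> h u v <= 1.
  move=> lt_um lt_vr; rewrite leq_subLR addn1 -residue_count_addm //.
  by apply: leq_residue_count => //; rewrite N_step // leq_add2l xs_nth.
have col v : v < r -> \sum_(u < m) h u v = nth 0 xs v.
  move=> lt_vr; rewrite sumnB; last first.
    by move=> u _; apply: leq_residue_count; rewrite ?N_step ?leq_addr.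
  by rewrite !sum_residue_count ?N_step ?addKn //; lia.
have row u : u < m -> \sum_(v < r) h u v = p + (u < e).
  move=> lt_um; rewrite -(big_mkord xpredT (h u)) telescope_sumn_in //.
    rewrite {2}/N take0 /N take_size sum_xs /residue_count div0n mod0n.
    by rewrite subn0 divnMDl ?modnMDl ?divn_small ?modn_small ?addn0; lia.
  by move=> v lt_vr; apply: leq_residue_count; rewrite ?N_step ?leq_addr; lia.
pose w x y := if x < m then if y < m then 1 else 1 - h x (y - m)
              else if y < m then 1 + h y (x - m) else 1.
exists w => [x y lt_x lt_y|].
  rewrite /w; case: (ltnP x m) => mx; case: (ltnP y m) => my //.
    by have := h_le1 x (y - m) mx ltac:(lia); lia.
  by have := h_le1 y (x - m) my ltac:(lia); lia.
(* This makes the truncated subtractions in the scores of the first block exact. *)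
have le_pr : p + (0 < e) <= r.
  by have := sumn_leq xs_m; rewrite sum_xs; case: (posnP e) => e0; nia.
rewrite iotaD add0n map_cat -[in iota 0 m](subnKC (ltnW lt_em)) iotaD.
rewrite map_cat add0n -catA !map_cat !map_nseq.
have rowE u : u < m -> \sum_(j < m + r) w u j = m + r - p - (u < e).
  move=> lt_um; rewrite big_split_ord /=.
  have draws : \sum_(v < r) (1 - h u v) = r - (p + (u < e)).
    rewrite -(row u) // sumnB => [|v _]; last exact: h_le1.
    by rewrite sum1_card card_ord.
  rewrite (eq_bigr (fun=> 1)) => [|j _]; last by rewrite /w lt_um ltn_ord.
  rewrite sum_nat_const card_ord.
  rewrite (eq_bigr (fun v : 'I_r => 1 - h u v)) => [|v _].
    by rewrite draws; lia.
  by rewrite /w lt_um ltnNge leq_addr addKn.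
rewrite (map_eq_nseq (y := (m + r - p.+2).+1)); last first.
  by move=> u; rewrite mem_iota => lt_ue; rewrite rowE; lia.
rewrite (map_eq_nseq (y := (m + r - p.+1).+1)); last first.
  by move=> u; rewrite mem_iota => lt_ue; rewrite rowE; lia.
rewrite !size_iota !perm_cat2l -map_comp.
rewrite -[m in iota m r]addn0 iotaDl -map_comp.
rewrite -[X in perm_eq _ (map _ X)](mkseq_nth 0) -map_comp.
suff /eq_in_map -> : {in iota 0 r,
    (fun i => \sum_(j < m + r) w i j) \o addn m =1
    (S \o addn (m + r).-1) \o nth 0 xs} by exact: perm_refl.
move=> v; rewrite mem_iota add0n /= => lt_vr; rewrite big_split_ord /=.
rewrite (eq_bigr (fun u : 'I_m => 1 + h u v)) => [|u _]; last first.
  by rewrite /w ltn_ord ltnNge leq_addr addKn.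
rewrite big_split /= col // sum_nat_const card_ord.
rewrite (eq_bigr (fun=> 1)) => [|u _]; last by rewrite /w !ltnNge !leq_addr.
by rewrite sum_nat_const card_ord; lia.
Qed.

(** * Shapes with a witness of incompleteness *)

Definition separating (lambda : seq nat) : Prop :=
  exists s : seq nat,
    [/\ score_multiset (sumn lambda) s, ~ char_multiset (sumn lambda) s &
        perm_eq (seq_shape s) lambda].

Lemma separating_incomplete (lambda : seq nat) :
  separating lambda -> ~ complete (sumn lambda) lambda.
Proof.
case=> s [score_s nchar_s shape_s] /(_ (sort leq s)) [_] [].
  split; first exact: score_multiset_sequence.
  by rewrite (permPl (seq_shape_perm (permEl (perm_sort leq s)))).
move=> /char_sequence_multiset[f [f_lt f_inj f_s]] _; apply: nchar_s.
by exists f; split=> //; rewrite (permPl f_s) perm_sort.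
Qed.

Lemma separating_perm (lambda mu : seq nat) :
  perm_eq lambda mu -> separating lambda -> separating mu.
Proof.
move=> lm [s [score_s nchar_s shape_s]]; exists s.
by rewrite -(perm_sumn lm) -(permPr lm).
Qed.

Lemma separating_cat (mu lambda : seq nat) :
  all (ltn 0) mu -> separating lambda -> separating (mu ++ lambda).
Proof.
move=> mu_gt0 sep; elim: mu mu_gt0 => //= p mu IHmu /andP[p_gt0 /IHmu].
case=> s [score_s nchar_s shape_s].
exists (nseq p p.-1 ++ map (addn p.*2) s); split.
- exact: score_multiset_block.
- by move=> /(char_multiset_block p_gt0).
rewrite seq_shape_nseq_cat // ?seq_shape_map ?perm_cons //; first exact: addnI.
by apply/mapP => -[x _]; lia.
Qed.

(* The scores below do not form a characteristic sequence, by
   [char_multiset_count]: with [n = m + size xs], [L = n - p.+1] and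
   [M = n + m - 2], only the [size xs] scores coming from [xs] exceed [L], but
   [minn p.*2 (size xs).+1] would be needed. *)
Lemma separating_cyclic (m p e : nat) (xs lambda : seq nat) :
  e < m -> all (gtn m) xs -> size xs < p.*2 -> sumn xs = p * m + e ->
  perm_eq lambda ([seq k <- [:: e; m - e] | 0 < k] ++ seq_shape xs) ->
  separating lambda.
Proof.
move=> lt_em lt_xs lt_r sum_xs shape_xs.
have le_xs : all (geq m.-1) xs by apply: sub_all lt_xs => x /=; lia.
(* The entries of [xs] are strictly below [m], so [p] of them cannot reach the sum [p * m]. *)
have lt_pr : p < size xs by have := sumn_leq le_xs; nia.
have sumE : sumn lambda = m + size xs.
  rewrite (perm_sumn shape_xs) sumn_cat sumn_seq_shape.
  by rewrite /=; case: (posnP e) => e0 /=; case: ltnP => /=; lia.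
exists (nseq e (m + size xs - p.+2) ++ nseq (m - e) (m + size xs - p.+1) ++
        map (addn (m + size xs).-1) xs); rewrite sumE; split.
- by apply: score_multiset_cyclic => //; apply: sub_all lt_xs => x /=; lia.
- move=> /(@char_multiset_count _ (m + size xs - p.+1) (m + size xs + m - 2)).
  rewrite !all_cat !all_nseq !count_cat !count_nseq all_map count_map /=.
  rewrite (eq_in_count (a2 := predT)) => [|x x_xs]; last first.
    by rewrite /=; lia.
  rewrite count_predT.
  have -> : all (preim (addn (m + size xs).-1)
                       (leq^~ (m + size xs + m - 2))) xs.
    by apply: sub_all lt_xs => x /=; lia.
  have -> : (m + size xs - p.+1 < m + size xs - p.+2) = false by lia.
  rewrite ltnn !mul0n !add0n => count_le.
  have {count_le} := count_le ltac:(lia).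
  by move: lt_em lt_r lt_pr; move: (size xs) => r; clear; lia.
have lead_notin x :
    x < (m + size xs).-1 -> x \notin map (addn (m + size xs).-1) xs.
  by move=> lt_x; apply/mapP => -[y _]; lia.
rewrite perm_sym (permPl shape_xs) /=.
have -> : 0 < m - e by lia.
case: (posnP e) => [e0|e_gt0] /=.
  rewrite e0 [nseq 0 _]/= cat0s subn0 seq_shape_nseq_cat ?seq_shape_map //.
  - exact: addnI.
  - by rewrite -e0.
  by apply: lead_notin; lia.
rewrite !seq_shape_nseq_cat ?seq_shape_map //.
- exact: addnI.
- by lia.
- by apply: lead_notin; lia.
rewrite mem_cat negb_or lead_notin ?mem_nseq; first by lia.
by lia.
Qed.

(** * The minimal separating shapes *)

(** With k the gcd, each of the [b] vertices beats a - a/k of the [a] others, each of which loses b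
    - b/k games; b < 2(b - b/k) amounts to k > 2. *)
Lemma separating_gcd (a b : nat) :
  0 < a -> 0 < b -> 2 < gcdn a b -> separating [:: a; b].
Proof.
move=> a_gt0 b_gt0.
have [/dvdnP[c ca] /dvdnP[d db]] := (dvdn_gcdl a b, dvdn_gcdr a b).
(* From here on [g] is the gcd minus one. *)
move: ca db; set g := gcdn a b => ca db; case: g ca db => // g ca db g_gt1.
apply: (@separating_cyclic a (g * d) 0 (nseq b (g * c))).
- by [].
- by rewrite all_nseq /=; nia.
- by rewrite size_nseq; nia.
- by rewrite sumn_nseq ca db; lia.
by rewrite /= subn0 a_gt0 seq_shape_nseq.
Qed.

(** The generic choice has first block [c] and wins [b] and [c - a], which coincide exactly when
    [c = a + b]. That case takes first block [b] and wins [1] and [b - 1]; here [c > 3] forces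
    [b > 2], so these differ. *)
Lemma separating_sorted3 (a b c : nat) :
  0 < a -> a < b -> b < c -> 3 < c -> separating [:: a; b; c].
Proof.
move=> a_gt0 lt_ab lt_bc c_gt3; have [cE|ne] := eqVneq c (a + b).
  rewrite {c}cE in lt_bc c_gt3 *.
  case: b lt_ab lt_bc c_gt3 => // b lt_ab lt_bc ab_gt3.
  apply: (@separating_cyclic b.+1 (a + b) 0 (nseq a 1 ++ nseq (a + b.+1) b)).
  - by [].
  - by rewrite all_cat !all_nseq /=; lia.
  - by rewrite size_cat !size_nseq; lia.
  - by rewrite sumn_cat !sumn_nseq; nia.
  rewrite /= subn0 seq_shape_nseq_cat ?seq_shape_nseq ?mem_nseq; try lia.
  exact: permEl (perm_catCA [:: a] [:: b.+1] _).
apply: (@separating_cyclic c b 0 (nseq a b ++ nseq b (c - a))).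
- by lia.
- by rewrite all_cat !all_nseq /=; lia.
- by rewrite size_cat !size_nseq; lia.
- by rewrite sumn_cat !sumn_nseq; nia.
rewrite /= subn0 seq_shape_nseq_cat ?seq_shape_nseq ?mem_nseq; try lia.
have -> : 0 < c by lia.
exact: permEl (perm_catC [:: a; b] [:: c]).
Qed.

(** The win counts must be three distinct numbers below [b] with sum [2 * b]; [b > 5] keeps 3 apart
    from [b - 2]. *)
Lemma separating_ones (b : nat) : 5 < b -> separating [:: 1; 1; 1; b].
Proof.
move=> b_gt5; apply: (@separating_cyclic b 2 0 [:: 3; b - 2; b - 1]).
- by lia.
- by rewrite /=; lia.
- by [].
- by rewrite /=; lia.
have -> : [:: 3; b - 2; b - 1] =
  nseq 1 3 ++ nseq 1 (b - 2) ++ nseq 1 (b - 1) by [].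
rewrite !seq_shape_nseq_cat ?seq_shape_nseq ?mem_cat ?mem_nseq //=; try lia.
rewrite (_ : 0 < b - 0) ?subn0; last lia.
exact: permEl (perm_catC [:: 1; 1; 1] [:: b]).
Qed.

Lemma separating_twos_even (b : nat) :
  5 < b -> ~~ odd b -> separating [:: 2; 2; b].
Proof.
move=> b_gt5 b_even; have bE := even_halfK b_even; move: b_gt5; rewrite -bE.
move: (b./2) => c c_gt.
(* Two doubled win counts summing to three times the first block force the latter to be even. *)
apply: (@separating_cyclic c.*2 3 0 (nseq 2 c.+1 ++ nseq 2 c.*2.-1)).
- by lia.
- by rewrite /=; lia.
- by [].
- by rewrite /=; lia.
rewrite !seq_shape_nseq_cat ?seq_shape_nseq ?mem_nseq //=; try lia.
rewrite (_ : 0 < c.*2 - 0) ?subn0; last lia.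
exact: permEl (perm_catC [:: 2; 2] [:: c.*2]).
Qed.

(** The win counts of [separating_ones], each doubled. *)
Lemma separating_twos (b : nat) : 5 < b -> separating [:: 2; 2; 2; b].
Proof.
move=> b_gt5.
apply: (@separating_cyclic b 4 0
  (nseq 2 3 ++ nseq 2 (b - 2) ++ nseq 2 (b - 1))).
- by lia.
- by rewrite /=; lia.
- by [].
- by rewrite /=; lia.
rewrite !seq_shape_nseq_cat ?seq_shape_nseq ?mem_cat ?mem_nseq //=; try lia.
rewrite (_ : 0 < b - 0) ?subn0; last lia.
exact: permEl (perm_catC [:: 2; 2; 2] [:: b]).
Qed.

(** The one use of a nonzero remainder: as 30 = 4 * 7 + 2, the first block splits into parts 2 and
    5. *)
Lemma separating_2_2_2_2_5 : separating [:: 2; 2; 2; 2; 5].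
Proof. by apply: (@separating_cyclic 7 4 2 [:: 4; 4; 5; 5; 6; 6]). Qed.

(** * Classification by the parts larger than two *)

Lemma separating_sub (mu nu lambda : seq nat) :
  separating mu -> all (ltn 0) nu -> perm_eq (nu ++ mu) lambda ->
  separating lambda.
Proof.
by move=> sep_mu nu_gt0 /separating_perm; apply; apply: separating_cat.
Qed.

Ltac perm_count :=
  apply/seq.permP => ?; do 2 rewrite /= ?(count_cat, count_nseq) /=; lia.

(** Two equal parts above 2 separate by their gcd. Otherwise the parts are distinct, and the largest
    exceeds 3 because two of them exceed 2. *)
Lemma separating_two_large (a b c : nat) :
  2 < a -> 2 < b -> 0 < c -> separating [:: a; b; c].
Proof.
move=> a_gt2 b_gt2 c_gt0.
have separating_eq x y : 2 < x -> 0 < y -> separating [:: x; x; y].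
  move=> x_gt2 y_gt0; apply: (@separating_sub [:: x; x] [:: y]).
  - by apply: separating_gcd; rewrite ?gcdnn; lia.
  - by rewrite /= y_gt0.
  - by perm_count.
wlog lt_ab : a b a_gt2 b_gt2 / a < b.
  move=> wlg.
  have [|lt_ba|->] := ltngtP a b; [exact: wlg | | exact: separating_eq].
  apply: (@separating_perm [:: b; a; c]); first by perm_count.
  exact: wlg.
have [lt_ca|lt_ac|->] := ltngtP c a.
- apply: (@separating_perm [:: c; a; b]); first by perm_count.
  by apply: separating_sorted3 => //; lia.
- have [lt_cb|lt_bc|->] := ltngtP c b.
  + apply: (@separating_perm [:: a; c; b]); first by perm_count.
    by apply: separating_sorted3 => //; lia.
  + by apply: separating_sorted3 => //; lia.
  apply: (@separating_perm [:: b; b; a]); first by perm_count.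
  by apply: separating_eq; lia.
apply: (@separating_perm [:: a; a; b]); first by perm_count.
by apply: separating_eq; lia.
Qed.

Lemma perm_ones_twos_large (lambda : seq nat) :
  all (ltn 0) lambda ->
  exists a b (large : seq nat),
    all (ltn 2) large /\ perm_eq lambda (nseq a 1 ++ nseq b 2 ++ large).
Proof.
elim: lambda => [_|x s IHs /= /andP[x_gt0 /IHs]]; first by exists 0, 0, [::].
case=> a [b [large [large_gt2 s_perm]]].
have [x1|x2|x_gt2] : [\/ x = 1, x = 2 | 2 < x].
  case: x x_gt0 => [|[|[|x]]] // _.
  - exact: Or31.
  - exact: Or32.
  exact: Or33.
- exists a.+1, b, large; split=> //.
  by rewrite x1 /= perm_cons.
- exists a, b.+1, large; split=> //.
  by rewrite x2 perm_sym (perm_catCA _ [:: 2]) /= perm_cons perm_sym.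
exists a, b, (x :: large); split; first by rewrite /= x_gt2.
rewrite perm_sym catA (perm_catCA _ [:: x]) /= perm_cons.
by rewrite -catA perm_sym.
Qed.

(** With no part above 2, [lambda] is in [Gamma]. With one, the numbers of ones and twos decide.
    With two, any third part makes it separating, and a bare pair is settled by its gcd. *)
Lemma separating_or_Gamma (lambda : seq nat) :
  0 < sumn lambda -> all (ltn 0) lambda -> separating lambda \/ Gamma lambda.
Proof.
move=> sum_gt0 /perm_ones_twos_large[a [b [large [large_gt2 lambda_perm]]]].
have sep mu nu : separating mu -> all (ltn 0) nu ->
    perm_eq (nu ++ mu) (nseq a 1 ++ nseq b 2 ++ large) -> separating lambda.
  move=> sep_mu nu_gt0 nu_mu; apply: (separating_sub sep_mu nu_gt0).
  by rewrite perm_sym (permPl lambda_perm) perm_sym.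
have large_gt0 : all (ltn 0) large by apply: sub_all large_gt2 => x /=; lia.
rewrite (perm_sumn lambda_perm) !sumn_cat !sumn_nseq in sum_gt0.
case: large large_gt2 large_gt0 lambda_perm sep sum_gt0 => [|x [|y large]].
- rewrite cats0 addn0 => _ _ lambda_perm _ sum_gt0; right.
  case: (posnP a) => [a0|a_gt0].
    apply: Or31; exists b; first by lia.
    by apply: Or33; rewrite a0 in lambda_perm.
  case: (posnP b) => [b0|b_gt0].
    apply: Or31; exists a => //.
    by apply: Or32; rewrite b0 cats0 in lambda_perm.
  by apply: Or32; right; left; exists a, b.
- rewrite /= !andbT => x_gt2 x_gt0 lambda_perm sep _.
  have sep_twos : 5 < x -> ~~ odd x -> 2 <= b -> separating lambda.
    move=> x_gt5 x_even; case: b sep {lambda_perm} => [|[|b]] // sep _.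
    apply: (sep _ (nseq a 1 ++ nseq b 2) (separating_twos_even x_gt5 x_even)).
      by rewrite all_cat !all_nseq !orbT.
    by perm_count.
  case: a lambda_perm sep => [|a] lambda_perm sep.
    case: b lambda_perm sep sep_twos => [|[|b]] lambda_perm sep sep_twos.
    + right; apply: Or31; exists x => //.
      by apply: Or31.
    + right; apply: Or32; left; exists 2, x; split=> //.
      by apply: dvdn_leq (dvdn_gcdl _ _).
    have [x_le4|x_gt4] := leqP x 4.
      right; apply: Or32; do 4 right; left; exists b.+2, x; split=> //.
      by lia.
    have [x_odd|x_even] := boolP (odd x); last first.
      by left; apply: sep_twos => //; lia.
    case: b lambda_perm sep {sep_twos} => [|b] lambda_perm sep.
      by right; apply: Or32; do 5 right; left; exists x.
    have [x5|x_gt5] : x = 5 \/ 5 < x by lia.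
      rewrite x5 in lambda_perm sep.
      case: b lambda_perm sep => [|b] lambda_perm sep.
        by right; apply: Or32; do 6 right.
      left; apply: (sep _ (nseq b 2) separating_2_2_2_2_5).
        by rewrite all_nseq orbT.
      by perm_count.
    left; apply: (sep _ (nseq b 2) (separating_twos x_gt5)).
      by rewrite all_nseq orbT.
    by perm_count.
  case: b lambda_perm sep {sep_twos} => [|b] lambda_perm sep; last first.
    have [x3|x_gt3] : x = 3 \/ 3 < x by lia.
      by right; apply: Or33; exists a.+1, b.+1; split=> //; rewrite -x3.
    left; apply: (sep [:: 1; 2; x] (nseq a 1 ++ nseq b 2)).
    + exact: separating_sorted3.
    + by rewrite all_cat !all_nseq !orbT.
    by perm_count.
  case: a lambda_perm sep => [|[|a]] lambda_perm sep.
  + right; apply: Or32; left; exists 1, x; split=> //.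
    by rewrite gcd1n.
  + by right; apply: Or32; do 3 right; left; exists x.
  have [x_le5|x_gt5] := leqP x 5.
    right; apply: Or32; do 2 right; left; exists a.+3, x; split=> //.
    by lia.
  left; apply: (sep _ (nseq a 1) (separating_ones x_gt5)).
    by rewrite all_nseq orbT.
  by perm_count.
rewrite /= => /and3P[x_gt2 y_gt2 _] /and3P[_ _ large_gt0] lambda_perm sep _.
case: a lambda_perm sep => [|a] lambda_perm sep; last first.
  left; apply: (sep [:: x; y; 1] (nseq a 1 ++ nseq b 2 ++ large)).
  - exact: separating_two_large.
  - by rewrite !all_cat !all_nseq !orbT.
  by perm_count.
case: b lambda_perm sep => [|b] lambda_perm sep; last first.
  left; apply: (sep [:: x; y; 2] (nseq b 2 ++ large)).
  - exact: separating_two_large.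
  - by rewrite !all_cat !all_nseq !orbT.
  by perm_count.
case: large large_gt0 lambda_perm sep => [|z large] /=.
  move=> _ lambda_perm sep; have [gcd_le2|gcd_gt2] := leqP (gcdn x y) 2.
    by right; apply: Or32; left; exists x, y; split=> //; lia.
  by left; apply: (sep [:: x; y] [::]) => //; apply: separating_gcd => //; lia.
move=> /andP[z_gt0 large_gt0] lambda_perm sep.
left; apply: (sep [:: x; y; z] large) => //; first exact: separating_two_large.
by perm_count.
Qed.

Theorem theorem4p16 (n : nat) (lambda : seq nat)
  (hn : 0 < n) (hlambda : is_partition n lambda) :
  complete n lambda -> Gamma lambda.
Proof.
case: hlambda => lambda_gt0 sum_lambda; subst n.
by have [/separating_incomplete|] := separating_or_Gamma hn lambda_gt0.
Qed.
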